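(* Let $G=(V,E)$ be an arbitrary finite simple graph with $V\neq\emptyset$, and let $a<b\le 2a$ be real numbers. Define a metric on $V$ as follows: the distance between two distinct vertices of $G$ is equal to $b$ if they are adjacent in $G$, and is equal to $a$ otherwise. If $m$ is the greatest positive integer such that $2d_{GH}(a\Delta,V)=b$, where $a\Delta$ is a simplex consisting of $m$ vertices whose non-zero distances equal $a$, then $\gamma(G)=m+1$.
   Context: A simplex is a metric space all of whose non-zero distances are equal; $a\Delta$ denotes a simplex whose non-zero distances equal $a>0$ (a one-point space if it consists of one vertex). $d_{GH}$ denotes the Gromov--Hausdorff distance: $d_{GH}(X,Y)$ is the infimum of all $r$ for which there exist a metric space $Z$ and subsets $X',Y'\subset Z$ isometric to $X$ and $Y$ respectively with Hausdorff distance $d_H(X',Y')\le r$. $\gamma(G)$ denotes the chromatic number of $G$: the least number of colors needed to color the vertices of $G$ so that adjacent vertices have different colors. *)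

(* Defs.v *)
From HB Require Import structures.
From mathcomp Require Import all_boot all_order all_algebra.
From mathcomp Require Import all_classical all_reals all_analysis.

Set Implicit Arguments.
Unset Strict Implicit.
Unset Printing Implicit Defensive.

Import Order.TTheory GRing.Theory Num.Theory.

Local Open Scope classical_set_scope.
Local Open Scope ring_scope.

Section gromov_hausdorff.
Context {R : realType}.

Lemma edist_mdist (Z : metricType R) (x y : Z) : edist (x, y) = (mdist x y)%:E.
Proof.
apply/eqP; rewrite eq_le; apply/andP; split.
  apply/lee_addgt0Pr => e e0; rewrite -EFinD; apply: edist_fin => /=.
    by rewrite ltr_wpDl// mdist_ge0.
  by rewrite ballEmdist/= ltrDl.
apply: le_ereal_inf_tmp => _ /= [r [_ +] <-].
by rewrite ballEmdist/= lee_fin => /ltW.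
Qed.

(* On a metric space, edist_inf A z is the distance from z to the set A. *)
Lemma edist_inf_mdist (Z : metricType R) (A : set Z) (z : Z) :
  edist_inf A z = ereal_inf [set (mdist z x)%:E | x in A].
Proof.
by rewrite /edist_inf; congr ereal_inf; apply: eq_imagel => x _;
  rewrite edist_mdist.
Qed.

Definition hausdorff_dist (Z : metricType R) (A B : set Z) : \bar R :=
  maxe (ereal_sup [set edist_inf B x | x in A])
       (ereal_sup [set edist_inf A y | y in B]).

(* Distance-preserving maps are injective, so f is a bijection onto A. *)
Definition isometric_to (X Z : metricType R) (A : set Z) : Prop :=
  exists2 f : X -> Z,
    (forall x y, mdist (f x) (f y) = mdist x y) & range f = A.

Definition gh_dist (X Y : metricType R) : \bar R :=
  ereal_inf [set r%:E | r in [set r : R |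
    exists (Z : metricType R) (X' Y' : set Z),
      [/\ isometric_to X X', isometric_to Y Y' &
          (hausdorff_dist X' Y' <= r%:E)%E]]].

End gromov_hausdorff.

Record sgraph := SGraph {
  vertex :> finType;
  adj : rel vertex;
  adj_sym : symmetric adj;
  adj_irr : irreflexive adj }.

Definition colorable (G : sgraph) (k : nat) : bool :=
  [exists c : {ffun G -> 'I_k},
    [forall x, forall y, adj x y ==> (c x != c y)]].

Lemma ex_colorable (G : sgraph) : exists k, colorable G k.
Proof.
exists #|G|; apply/existsP; exists [ffun x => enum_rank x].
apply/forallP => x; apply/forallP => y; apply/implyP => xy; rewrite !ffunE.
by apply: contraTneq xy => /enum_rank_inj ->; rewrite adj_irr.
Qed.

Definition chromatic_number (G : sgraph) : nat := ex_minn (ex_colorable G).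

(* The proof arguments below are carried by the types because the metric
   space axioms of the declared instances depend on them. *)
Definition simplex (R : realType) (a : R) (a_gt0 : 0 < a) (m : nat) : Type :=
  'I_m.

Section simplex_metric.
Context {R : realType} (a : R) (a_gt0 : 0 < a) (m : nat).
Local Notation T := (simplex a_gt0 m).

HB.instance Definition _ := Choice.copy T 'I_m.

Definition simplex_dist (x y : T) : R := if x == y then 0 else a.

Let dxx x : simplex_dist x x = 0.
Proof. by rewrite /simplex_dist eqxx. Qed.

Let dpos x y : simplex_dist x y = 0 -> x = y.
Proof.
by rewrite /simplex_dist; case: eqP => // _ /eqP; rewrite gt_eqF.
Qed.

Let dsym x y : simplex_dist x y = simplex_dist y x.
Proof. by rewrite /simplex_dist eq_sym. Qed.

Let dtri y x z : simplex_dist x z <= simplex_dist x y + simplex_dist y z.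
Proof.
have a0 := ltW a_gt0; rewrite /simplex_dist.
case: (eqVneq x y) => [->|_]; first by rewrite add0r.
case: (eqVneq y z) => _; first by rewrite addr0; case: eqP.
by case: eqP => _; rewrite ?addr_ge0// lerDl.
Qed.

HB.instance Definition _ := isMetric.Build R T dxx dpos dsym dtri.

End simplex_metric.

Lemma lt_le_double_gt0 (R : realType) (a b : R) :
  a < b -> b <= 2 * a -> 0 < a.
Proof.
by move=> ab ba; have := lt_le_trans ab ba; rewrite mulr2n mulrDl mul1r ltrDl.
Qed.

Definition graph_space (R : realType) (G : sgraph) (a b : R)
  (ab : a < b) (ba : b <= 2 * a) : Type := vertex G.

Section graph_space_metric.
Context {R : realType} (G : sgraph) (a b : R) (ab : a < b) (ba : b <= 2 * a).
Local Notation T := (graph_space G ab ba).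

HB.instance Definition _ := Choice.copy T (vertex G).

Definition graph_dist (x y : T) : R :=
  if x == y then 0 else if adj (x : G) y then b else a.

Let a_gt0 : 0 < a := lt_le_double_gt0 ab ba.

Let dxx x : graph_dist x x = 0.
Proof. by rewrite /graph_dist eqxx. Qed.

Let dge x y : x != y -> a <= graph_dist x y.
Proof. by rewrite /graph_dist => /negPf ->; case: ifP => // _; exact: ltW. Qed.

Let dle x y : graph_dist x y <= a + a.
Proof.
have a0 := ltW a_gt0; have aa : 2 * a = a + a by rewrite mulr2n mulrDl mul1r.
rewrite /graph_dist; case: ifP => _; first exact: addr_ge0.
by case: ifP => _; rewrite -?aa// aa lerDl.
Qed.

Let dpos x y : graph_dist x y = 0 -> x = y.
Proof.
case: (eqVneq x y) => // xy d0.
by have := lt_le_trans a_gt0 (dge xy); rewrite d0 ltxx.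
Qed.

Let dsym x y : graph_dist x y = graph_dist y x.
Proof. by rewrite /graph_dist eq_sym adj_sym. Qed.

Let dtri y x z : graph_dist x z <= graph_dist x y + graph_dist y z.
Proof.
case: (eqVneq x y) => [->|xy]; first by rewrite dxx add0r.
case: (eqVneq y z) => [->|yz]; first by rewrite dxx addr0.
by apply: le_trans (dle _ _) _; apply: lerD; exact: dge.
Qed.

HB.instance Definition _ := isMetric.Build R T dxx dpos dsym dtri.

End graph_space_metric.

(* Main.v *)
Require Import Defs.
From HB Require Import structures.
From mathcomp Require Import all_boot all_order all_algebra.
From mathcomp Require Import all_classical all_reals all_analysis.
From mathcomp Require Import lra.

(** Write [k] for the number of vertices of the simplex.  The theorem follows
    from a dichotomy: for [0 < k], twice the distance from the [k]-point simplex
    to the graph space is at most [a] if the graph is [k]-colorable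
    ([gh_dist_colorable]), and exactly [b] otherwise ([gh_dist_noncolorable]).
    As [a < b] and colorability is monotone in [k], the greatest [k] for which
    the value [b] is reached is the last one before the chromatic number.

    Upper bounds come from putting a metric on the disjoint union of the two
    spaces ([gh_dist_le_coupling]).  The constant cross distance [b / 2] always
    works, because no distance exceeds [b].  A [k]-coloring does better: a
    vertex is put at distance [a / 2] from its color, and at [3 * a / 2] from
    the other colors in use.  Two vertices at distance [a / 2] from the same color are
    not adjacent, so their distance, at most [a], satisfies the triangle
    inequality; any other pair is joined through a color by a path of length at
    least [2 * a >= b].

    For the lower bound, if both spaces lie in a common metric space at
    Hausdorff distance less than [b / 2], sending each vertex to a simplex point
    less than [b / 2] away separates vertices at distance [b]
    ([gh_dist_lt_map]), hence is a coloring. *)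

Set Implicit Arguments.
Unset Strict Implicit.
Unset Printing Implicit Defensive.

Import Order.TTheory GRing.Theory Num.Theory.

Local Open Scope classical_set_scope.
Local Open Scope ring_scope.

(** * Gromov-Hausdorff distance and metrics on a disjoint union *)

(** The conditions on a cross distance [f] under which it extends the metrics of
    [X] and [Y] to a metric on their disjoint union. *)
Record coupling (R : realType) (X Y : metricType R) (f : X -> Y -> R) : Prop :=
  Coupling {
    coupling_gt0 : forall x y, 0 < f x y;
    coupling_lipl : forall x x' y, f x y <= mdist x x' + f x' y;
    coupling_lipr : forall x y y', f x y <= f x y' + mdist y' y;
    coupling_dl : forall x x' y, mdist x x' <= f x y + f x' y;
    coupling_dr : forall x y y', mdist y y' <= f x y + f x y' }.

(** The coupling is an argument of the type so that the metric structure
    declared on it can refer to the proof of the triangle inequality. *)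
Definition glue (R : realType) (X Y : metricType R) (f : X -> Y -> R)
  (fC : coupling f) : Type := (X + Y)%type.

Section glue_metric.
Context {R : realType} (X Y : metricType R) (f : X -> Y -> R) (fC : coupling f).
Local Notation T := (glue fC).

HB.instance Definition _ := Choice.copy T (X + Y)%type.

Definition glue_dist (u v : T) : R :=
  match u, v with
  | inl x, inl x' => mdist x x'
  | inl x, inr y => f x y
  | inr y, inl x => f x y
  | inr y, inr y' => mdist y y'
  end.

Let dxx u : glue_dist u u = 0.
Proof. by case: u => ? /=; rewrite mdistxx. Qed.

Let dpos u v : glue_dist u v = 0 -> u = v.
Proof.
case: u v => [x|y] [x'|y'] /=; first by move/mdist_positivity => ->.
- by move=> f0; have := coupling_gt0 fC x y'; rewrite f0 ltxx.
- by move=> f0; have := coupling_gt0 fC x' y; rewrite f0 ltxx.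
- by move/mdist_positivity => ->.
Qed.

Let dsym u v : glue_dist u v = glue_dist v u.
Proof. by case: u v => [x|y] [x'|y'] //=; rewrite metric_sym. Qed.

Let dtri v u w : glue_dist u w <= glue_dist u v + glue_dist v w.
Proof.
case: u v w => [x|y] [x'|y'] [x''|y''] /=.
- exact: metric_triangle.
- exact: coupling_lipl.
- exact: coupling_dl.
- exact: coupling_lipr.
- by rewrite addrC metric_sym; exact: coupling_lipl.
- exact: coupling_dr.
- by rewrite addrC metric_sym; exact: coupling_lipr.
- exact: metric_triangle.
Qed.

HB.instance Definition _ := isMetric.Build R T dxx dpos dsym dtri.

End glue_metric.

Lemma hausdorff_dist_le (R : realType) (Z : metricType R) (A B : set Z) (r : R) :
  (forall x, A x -> exists2 y, B y & mdist x y <= r) ->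
  (forall y, B y -> exists2 x, A x & mdist y x <= r) ->
  (hausdorff_dist A B <= r%:E)%E.
Proof.
move=> AB BA; rewrite /hausdorff_dist ge_max; apply/andP; split.
- apply: ge_ereal_sup => _ [x Ax <-]; have [y By xy] := AB x Ax.
  rewrite edist_inf_mdist; apply: (@le_trans _ _ (mdist x y)%:E).
    by apply: ereal_inf_lbound; exists y.
  by rewrite lee_fin.
- apply: ge_ereal_sup => _ [y By <-]; have [x Ax yx] := BA y By.
  rewrite edist_inf_mdist; apply: (@le_trans _ _ (mdist y x)%:E).
    by apply: ereal_inf_lbound; exists x.
  by rewrite lee_fin.
Qed.

(** The two copies lie within Hausdorff distance [r] of each other inside the
    glued space. *)
Lemma gh_dist_le_coupling (R : realType) (X Y : metricType R)
    (f : X -> Y -> R) (r : R) :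
  coupling f ->
  (forall x, exists y, f x y <= r) -> (forall y, exists x, f x y <= r) ->
  (gh_dist X Y <= r%:E)%E.
Proof.
move=> fC Xr Yr; apply: ereal_inf_lbound; exists r => //.
pose i (x : X) : glue fC := inl x; pose j (y : Y) : glue fC := inr y.
exists (glue fC), (range i), (range j); split; [by exists i|by exists j|].
apply: hausdorff_dist_le => _ [u _ <-].
- by have [y ?] := Xr u; exists (j y) => //; exists y.
- by have [x ?] := Yr u; exists (i x) => //; exists x.
Qed.

(** The map sends [y] to a point less than [t] away from it in the common
    space; the inequality is the triangle inequality there. *)
Lemma gh_dist_lt_map (R : realType) (X Y : metricType R) (t : R) :
  (gh_dist X Y < t%:E)%E ->
  exists c : Y -> X, forall y y', mdist y y' < mdist (c y) (c y') + 2 * t.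
Proof.
move=> /ereal_inf_lt [_ [r [Z [A [B [[i iI iA] [j jI jB] hr]]]] <-]] rt.
have near_pt y : exists x, mdist (j y) (i x) < t.
  have : (edist_inf A (j y) < t%:E)%E.
    apply: le_lt_trans rt; apply: le_trans hr.
    rewrite /hausdorff_dist le_max; apply/orP; right.
    by apply: ereal_sup_ubound; exists (j y) => //; rewrite -jB; exists y.
  rewrite edist_inf_mdist => /ereal_inf_lt [_ [z Az <-]].
  by move: Az; rewrite -iA => -[x _ <-]; rewrite lte_fin => ?; exists x.
have [c cP] := choice near_pt; exists c => y y'.
have := metric_triangle (j y) (i (c y)) (j y').
have := metric_triangle (i (c y)) (i (c y')) (j y').
have := cP y; have := cP y'.
rewrite jI iI (metric_sym (j y')); lra.
Qed.

(** * Colorings *)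

Lemma colorableP (G : sgraph) (k : nat) :
  reflect (exists c : G -> 'I_k, forall x y, adj x y -> c x != c y)
          (colorable G k).
Proof.
apply: (iffP existsP) => [[c cP]|[c cP]].
  by exists c => x y xy; move/forallP/(_ x)/forallP/(_ y)/implyP : cP; exact.
exists [ffun x => c x]; apply/forallP => x; apply/forallP => y.
by apply/implyP => xy; rewrite !ffunE cP.
Qed.

Lemma leq_colorable (G : sgraph) (k l : nat) :
  (k <= l)%N -> colorable G k -> colorable G l.
Proof.
move=> kl /colorableP[c cP]; apply/colorableP.
by exists (fun x => widen_ord kl (c x)) => x y /cP.
Qed.

Lemma chromatic_numberS (G : sgraph) (k : nat) :
  ~~ colorable G k -> colorable G k.+1 -> chromatic_number G = k.+1.
Proof.
move=> Nk Sk; rewrite /chromatic_number; case: ex_minnP => n cn n_min.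
apply/eqP; rewrite eqn_leq n_min //= ltnNge.
by apply: contra Nk => nk; apply: leq_colorable cn.
Qed.

(** * Distance from a simplex to a graph space *)

Section simplex_graph.
Context {R : realType} (G : sgraph) (a b : R) (ab : a < b) (ba : b <= 2 * a).
Let a_gt0 : 0 < a := lt_le_double_gt0 ab ba.
Local Notation S k := (simplex (lt_le_double_gt0 ab ba) k).
Local Notation V := (graph_space G ab ba).

Lemma simplex_mdist k (x y : S k) : mdist x y = if x == y then 0 else a.
Proof. by []. Qed.

Lemma graph_mdist (x y : V) :
  mdist x y = if x == y then 0 else if adj (x : G) y then b else a.
Proof. by []. Qed.

Lemma gh_dist_simplex_le k : (0 < k)%N -> (0 < #|G|)%N ->
  (gh_dist (S k) V <= (b / 2)%:E)%E.
Proof.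
move=> k0 /card_gt0P[v0 _]; have a0 := a_gt0.
apply: (@gh_dist_le_coupling _ _ _ (fun _ _ => b / 2)).
- split=> [x y|x x' y|x y y'|x x' y|x y y'].
  + by have := ab; lra.
  + by rewrite lerDr mdist_ge0.
  + by rewrite lerDl mdist_ge0.
  + by rewrite simplex_mdist; case: ifP => _; have := ab; lra.
  + by rewrite graph_mdist; do 2?case: ifP => _; have := ab; lra.
- by exists (v0 : V).
- by exists (Ordinal k0 : S k).
Qed.

(** Colors that occur on no vertex are matched with one vertex [v0], so that
    every simplex point has a vertex at distance [a / 2]. *)
Lemma gh_dist_colorable k : (0 < #|G|)%N -> colorable G k ->
  (gh_dist (S k) V <= (a / 2)%:E)%E.
Proof.
move=> /card_gt0P[v0 _] /colorableP[c cP]; have a0 := a_gt0.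
pose paired (i : S k) (v : V) :=
  (c v == i) || ((v == v0) && [forall w, c w != i]).
have paired_indep i v w : paired i v -> paired i w -> ~~ adj (v : G) w.
  move=> iv iw; apply/negP => vw; case/orP: iv => [/eqP iv|/andP[/eqP ev Ni]].
    case/orP: iw => [/eqP iw|/andP[_ /forallP/(_ v)]]; last by rewrite iv eqxx.
    by have := cP _ _ vw; rewrite iv iw eqxx.
  case/orP: iw => [/eqP iw|/andP[/eqP ew _]].
    by have /forallP/(_ w) := Ni; rewrite iw eqxx.
  by move: vw; rewrite ev ew adj_irr.
(* The value [3 * a / 2] is [a / 2 + a], the length of a path through a paired
   point at distance [a], so it cannot be larger; it cannot be smaller either
   when [b = 2 * a], as two adjacent vertices need [b <= a / 2 + 3 * a / 2]. *)
apply: (@gh_dist_le_coupling _ _ _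
  (fun i v => if paired i v then a / 2 else 3 * a / 2)).
- split=> [x y|x x' y|x y y'|x x' y|x y y'].
  + by case: ifP => _; lra.
  + rewrite simplex_mdist; case: eqP => [->|_]; first by rewrite add0r.
    by do 2?case: ifP => _; lra.
  + rewrite graph_mdist; case: eqP => [->|_]; first by rewrite addr0.
    by have := ab; do 3?case: ifP => _; lra.
  + by rewrite simplex_mdist; do 3?case: ifP => _; lra.
  + rewrite graph_mdist; have := ab; have := ba.
    case: (boolP (paired x y)) => xy; case: (boolP (paired x y')) => xy';
      do 1?[rewrite (negPf (paired_indep _ _ _ xy xy'))];
      by do 2?case: ifP => _; lra.
- move=> i; have [Ni|/forallPn[v]] := boolP [forall w, c w != i].
    by exists v0; rewrite /paired eqxx Ni orbT.
  by rewrite negbK => iv; exists v; rewrite /paired iv.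
- by move=> v; exists (c v); rewrite /paired eqxx.
Qed.

Lemma gh_dist_noncolorable k : (0 < k)%N -> (0 < #|G|)%N ->
  ~~ colorable G k -> gh_dist (S k) V = (b / 2)%:E.
Proof.
move=> k0 G0 Nk; apply/eqP; rewrite eq_le gh_dist_simplex_le //= leNgt.
apply: contra Nk => /gh_dist_lt_map[c cP]; apply/colorableP.
exists c => x y xy; apply/eqP => cxy; have := cP x y.
rewrite simplex_mdist graph_mdist cxy eqxx xy.
by case: eqP xy => [->|_ _]; [rewrite adj_irr|lra].
Qed.

End simplex_graph.

Theorem corollary2p15 (R : realType) (G : sgraph) (G_neq0 : (0 < #|G|)%N)
  (a b : R) (ab : a < b) (ba : b <= 2 * a) (m : nat) :
  let GH (k : nat) : \bar R :=
    gh_dist (simplex (lt_le_double_gt0 ab ba) k) (graph_space G ab ba) in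
  (0 < m)%N ->
  (2%:E * GH m = b%:E)%E ->
  (forall k : nat, (0 < k)%N -> (2%:E * GH k = b%:E)%E -> (k <= m)%N) ->
  chromatic_number G = (m + 1)%N.
Proof.
move=> GH m0 GHm m_max; rewrite addn1; apply: chromatic_numberS.
- apply/negP => cm; have := gh_dist_colorable ab ba G_neq0 cm.
  rewrite -(@lee_pmul2l _ 2%:E) // -/(GH m) GHm -EFinM lee_fin.
  by have := ab; lra.
- apply: contraT => Nm; have := m_max m.+1 isT; rewrite ltnn; apply.
  by rewrite /GH gh_dist_noncolorable // -EFinM mulrC divfK.
Qed.
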